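(* Suppose that the dependent (panel) sampling scheme described in the context is applied at stages 1 and 2, let $p=F(\tau)\in(0,1)$, and assume that one of the following is satisfied: (i) $X_{01},\dots,X_{0m}$ is an i.i.d. sample with common distribution function $F_0(x)=F(x-\Delta)$ and Assumption Q holds; (ii) Assumption Q' is satisfied. Then $$\begin{pmatrix} T_{n1} \\ T_{n2} \end{pmatrix}=\begin{pmatrix}\overline{X}_1^* \\ \overline{X}_2^*\end{pmatrix}-\begin{pmatrix}\sqrt{n_1}\,G_m^{-1}(p) \\ \sqrt{n_2}\,G_m^{-1}(p)\end{pmatrix}+o_P(1),$$ as $\min(n_1,n_2)\to\infty$ with $n_1/n_2\to\lambda$ and $\max(n_1,n_2)/m=o(1)$.
   Context: Distributional model. $F$ is a distribution function with finite fourth moment, mean $\mu$ and variance $\sigma^2\in(0,\infty)$, and $F(x)=G((x-\mu)/\sigma)$, where $G$ is a fixed unknown distribution function with $\int x\,dG(x)=0$ and $\int x^2\,dG(x)=1$. Quantile functions are denoted $F^{-1}$, $G^{-1}$, $F_0^{-1}$, so that $F^{-1}(p)=\mu+\sigma G^{-1}(p)$. The number $\tau$ is a specification limit; an item with measurement $X\le\tau$ is non-conforming, and $p=F(\tau)$ is the fraction of non-conforming items, with $\tau=F^{-1}(p)$. Samples. The additional sample $X_{01},\dots,X_{0m}$ (time $t_0$) consists of i.i.d. measurements with distribution function $F_0(x)=F(x-\Delta)$ for some constant $\Delta\in\mathbb{R}$ and is independent of the observations taken at later times. The control sample $X_{11},\dots,X_{1n_1}$ (time $t_1$) is i.i.d.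 with distribution function $F$. The inspection sample $X_{21},\dots,X_{2n_2}$ (time $t_2$) is i.i.d. with distribution function $F$. (Inspection measurements are in general distributed as $dX$ with $X\sim F$ and a known degradation constant $d\in(0,\infty)$; the convention is that they have already been multiplied by $D=1/d$.) Dependent (panel) sampling scheme. - If $n_2<n_1$, a subsample of $n_2$ of the items drawn at time $t_1$ is remeasured at time $t_2$, giving pairs $(X_{1i},X_{2i})$, $i=1,\dots,n_2$. - If $n_2>n_1$, all $n_1$ items drawn at time $t_1$ are remeasured, giving pairs $(X_{1i},X_{2i})$, $i=1,\dots,n_1$, and $n_2-n_1$ additional new items are drawn from the lot and measured at time $t_2$. The two measurements $X_{1i},X_{2i}$ of the same item are dependent; the pairs are identically distributed as $(X_1,X_2)$, with $\operatorname{Cor}(X_1,X_2)\neq0$. Measurements of different items are independent. The sample sizes satisfy $\lim n_1/n_2=\lambda$. Statistics. $\overline{X}_0=\frac1m\sum_{i=1}^mX_{0i}$, $S_m=\sqrt{\frac{1}{m-1}\sum_{i=1}^m(X_{0i}-\overline{X}_0)^2}$, and, for $i=1,2$, $\overline{X}_i=\frac1{n_i}\sum_{j=1}^{n_i}X_{ij}$, $$T_{ni}=\sqrt{n_i}\,\frac{\overline{X}_i-\tau}{S_m},\qquad \overline{X}_i^*=\sqrt{n_i}\,\frac{\overline{X}_i-\mu}{\sigma}.$$ Assumption Q: one of the following holds, for estimators calculated from the additional sample. (i) $G_m^{-1}(p)$ is an estimator of $G^{-1}(p)$ with $\sqrt{m}\,(G_m^{-1}(p)-G^{-1}(p))\stackrel{d}{\to}V$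 as $m\to\infty$ for some random variable $V$. (ii) $F_m^{-1}(p)$ is an estimator of $F_0^{-1}(p)$ with $\sqrt{m}\,(F_m^{-1}(p)-F_0^{-1}(p))\stackrel{d}{\to}U$ as $m\to\infty$ for some random variable $U$. Assumption Q': $F_m^{-1}(p)$ is an estimator of the quantile function $F_0^{-1}(p)$, $0<p<1$, calculated from the additional sample, with $\sqrt{m}\,(F_m^{-1}(p)-F_0^{-1}(p))\stackrel{d}{\to}\mathcal{F}(p)$ as $m\to\infty$ for some random process $\{\mathcal{F}(p):0<p<1\}$, in the sense of weak convergence of stochastic processes indexed by $p\in(0,1)$. When only an estimator $F_m^{-1}(p)$ of $F_0^{-1}(p)$ is given (Assumption Q(ii) or Assumption Q'), one sets $G_m^{-1}(p):=(F_m^{-1}(p)-\overline{X}_0)/S_m$. Here $o_P(1)$ denotes a term converging to $0$ in probability. *)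

(* Defs.v *)
(* MathComp-Analysis *)
From HB Require Import structures.
From mathcomp Require Import all_boot all_order all_algebra.
From mathcomp Require Import all_classical all_reals all_analysis.

Set Implicit Arguments.
Unset Strict Implicit.
Unset Printing Implicit Defensive.

Import Order.TTheory GRing.Theory Num.Theory.
Import numFieldNormedType.Exports.

Local Open Scope classical_set_scope.
Local Open Scope ring_scope.

Section Distributions.
Context {R : realType}.

Definition quantile (F : R -> R) (p : R) : R := inf [set x | p <= F x].

(* A distribution function is a [cumulativeBounded 0 1]: nondecreasing, right
   continuous, with limits 0 and 1 at -oo and +oo.  The clauses [ls_meanF] and
   [ls_varF] follow from the others. *)
Record location_scale (F G : cumulativeBounded (0 : R) (1 : R)) (mu sigma : R)
    : Prop := {
  ls_sigma : 0 < sigma;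
  ls_FG : forall x, F x = G ((x - mu) / sigma);
  ls_meanG : (\int[lebesgue_stieltjes_measure G]_x x%:E = 0)%E;
  ls_varG : (\int[lebesgue_stieltjes_measure G]_x (x ^+ 2)%:E = 1)%E;
  ls_meanF : (\int[lebesgue_stieltjes_measure F]_x x%:E = mu%:E)%E;
  ls_varF : (\int[lebesgue_stieltjes_measure F]_x ((x - mu) ^+ 2)%:E
             = (sigma ^+ 2)%:E)%E;
  ls_fourth : (\int[lebesgue_stieltjes_measure F]_x (x ^+ 4)%:E < +oo)%E }.

End Distributions.

(* Paths on (0, 1) with the topology of uniform convergence on the compact
   subsets of (0, 1); the values of a path outside (0, 1) are irrelevant to this
   topology. *)
Notation path01 R :=
  {family compactly_in (`]0%R, 1%R[%classic : set R), R -> R}.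

Section Probability.
Context {d : measure_display} {T : measurableType d} {R : realType}.
Variable P : probability T R.

Definition has_df (X : {RV P >-> R}) (F : R -> R) : Prop :=
  forall x, cdf X x = (F x)%:E.

Definition correlation (X Y : {RV P >-> R}) : R :=
  fine (covariance P X Y) / Num.sqrt (fine 'V_P[X]%E * fine 'V_P[Y]%E).

Definition same_joint_law (X Y X' Y' : {RV P >-> R}) : Prop :=
  forall B : set (R * R), measurable B ->
    P [set w | B (X w, Y w)] = P [set w | B (X' w, Y' w)].

Definition sigma_RV (X : {RV P >-> R}) : set_system T :=
  [set A | exists2 B : set R, measurable B & A = X @^-1` B].

Definition mutually_independent {I : eqType} (S : I -> set_system T) : Prop :=
  forall (J : seq I) (A : I -> set T), uniq J ->
    (forall i, i \in J -> S i (A i)) ->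
    P (\bigcap_(i in [set` J]) A i) = (\prod_(i <- J) P (A i))%E.

Definition independent_sigma (S S' : set_system T) : Prop :=
  forall A B, S A -> S' B -> P (A `&` B) = (P A * P B)%E.

Definition converges_in_distribution (Z : nat -> T -> R)
    {d' : measure_display} {T' : measurableType d'} (P' : probability T' R)
    (V : {RV P' >-> R}) : Prop :=
  forall f : R -> R, continuous f -> bounded_fun f ->
    'E_P[f \o Z n]%E @[n --> \oo] --> 'E_P'[f \o V]%E.

Definition outer_expectation (h : T -> R) : \bar R :=
  ereal_inf [set 'E_P[Y]%E | Y in
    [set Y : T -> R | P.-integrable setT (EFin \o Y) /\
                      forall w, h w <= Y w]].

(* Weak convergence in the sense of Hoffmann-Jorgensen: the processes Z_n need
   not be Borel measurable as maps into the path space, the limit is. *)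
Definition weakly_converges (Z : nat -> T -> path01 R)
    {d' : measure_display} {T' : measurableType d'} (P' : probability T' R)
    (Y : T' -> path01 R) : Prop :=
  (forall U : set (path01 R), open U -> measurable (Y @^-1` U)) /\
  forall f : path01 R -> R, continuous f -> bounded_fun f ->
    outer_expectation (f \o Z n) @[n --> \oo] --> 'E_P'[f \o Y]%E.

Definition oP1 (Z : nat -> T -> R * R) : Prop :=
  forall e : R, 0 < e -> P [set w | e < `|Z n w|] @[n --> \oo] --> 0%E.

End Probability.

Section Statistics.
Context {R : realType}.

Definition sample_mean {n} (x : n.-tuple R) : R := (\sum_(i < n) tnth x i) / n%:R.

Definition sample_sd {n} (x : n.-tuple R) : R :=
  Num.sqrt ((\sum_(i < n) (tnth x i - sample_mean x) ^+ 2) / n.-1%:R).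

Definition statistic := forall m : nat, m.-tuple R -> R.

Definition measurable_statistic (h : statistic) : Prop :=
  forall m, measurable_fun [set: m.-tuple R] (h m).

Definition standardized_statistic (h : statistic) : statistic :=
  fun m x => (h m x - sample_mean x) / sample_sd x.

Definition T_stat (tau S : R) {n} (x : n.-tuple R) : R :=
  Num.sqrt n%:R * ((sample_mean x - tau) / S).

Definition standardized_mean (mu sigma : R) {n} (x : n.-tuple R) : R :=
  Num.sqrt n%:R * ((sample_mean x - mu) / sigma).

End Statistics.

Section Sampling.
Context {d : measure_display} {T : measurableType d} {R : realType}.
Variable P : probability T R.

Definition sample (X : nat -> {RV P >-> R}) (n : nat) (w : T) : n.-tuple R :=
  [tuple X i w | i < n].

Definition iid_sample (X : nat -> {RV P >-> R}) (F : R -> R) : Prop :=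
  (forall i, has_df (X i) F) /\ mutually_independent P (fun i => sigma_RV (X i)).

(* The measurements made on the item of index i at the two stages: X1 i is
   observed if i < n1, X2 i if i < n2. *)
Definition item_sigma (n1 n2 : nat) (X1 X2 : nat -> {RV P >-> R}) (i : nat)
    : set_system T :=
  <<s [set A | ((i < n1)%N /\ sigma_RV (X1 i) A) \/
               ((i < n2)%N /\ sigma_RV (X2 i) A)] >>.

Definition sigma_all (X : nat -> {RV P >-> R}) : set_system T :=
  <<s [set A | exists i, sigma_RV (X i) A] >>.

Definition items_sigma (n1 n2 : nat) (X1 X2 : nat -> {RV P >-> R})
    : set_system T :=
  <<s [set A | exists i, item_sigma n1 n2 X1 X2 i A] >>.

(* Items are numbered so that those measured at both stages are the items
   i < minn n1 n2; the remaining items, i < maxn n1 n2, are measured only at the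
   first stage (if n2 < n1) or only at the second one (if n1 < n2).  (Y1, Y2) is
   the generic pair, and X0 the additional sample.  Only the values X1 i with
   i < n1 and X2 i with i < n2 matter. *)
Record panel_scheme (F : R -> R) (Y1 Y2 : {RV P >-> R})
    (X0 : nat -> {RV P >-> R}) (n1 n2 : nat) (X1 X2 : nat -> {RV P >-> R})
    : Prop := {
  ps_df1 : forall i, (i < n1)%N -> has_df (X1 i) F;
  ps_df2 : forall i, (i < n2)%N -> has_df (X2 i) F;
  ps_pairs : forall i, (i < minn n1 n2)%N -> same_joint_law (X1 i) (X2 i) Y1 Y2;
  ps_cor : correlation Y1 Y2 != 0;
  ps_items : mutually_independent P (item_sigma n1 n2 X1 X2);
  ps_X0 : independent_sigma P (sigma_all X0) (items_sigma n1 n2 X1 X2) }.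

End Sampling.

Section QuantileEstimation.
Context {d : measure_display} {T : measurableType d} {R : realType}.
Variables (P : probability T R) (X0 : nat -> {RV P >-> R}).

Definition scaled_error (h : statistic) (theta : R) (m : nat) (w : T) : R :=
  Num.sqrt m%:R * (h m (sample X0 m w) - theta).

Definition root_m_limit (h : statistic) (theta : R) : Prop :=
  exists (d' : measure_display) (T' : measurableType d')
         (P' : probability T' R) (V : {RV P' >-> R}),
    converges_in_distribution P (scaled_error h theta) V.

Definition estimates_G_quantile (G : R -> R) (p : R) (Gm : statistic) : Prop :=
  measurable_statistic Gm /\ root_m_limit Gm (quantile G p).

Definition estimates_F0_quantile (F0 : R -> R) (p : R) (Fm : statistic) : Prop :=
  measurable_statistic Fm /\ root_m_limit Fm (quantile F0 p).

(* Assumption Q, for the resulting estimator Gm of G^-1(p): Gm is given directly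
   in the first case, and derived from an estimator Fm of F_0^-1(p) in the
   second. *)
Definition assumption_Q (F0 G : R -> R) (p : R) (Gm : statistic) : Prop :=
  estimates_G_quantile G p Gm \/
  exists2 Fm : statistic, estimates_F0_quantile F0 p Fm &
    Gm = standardized_statistic Fm.

Definition quantile_process (F0 : R -> R) (Fm : R -> statistic) (m : nat) (w : T)
    : path01 R :=
  fun q => scaled_error (Fm q) (quantile F0 q) m w.

Definition estimates_F0_quantile_process (F0 : R -> R) (Fm : R -> statistic)
    : Prop :=
  (forall q, 0 < q < 1 -> measurable_statistic (Fm q)) /\
  exists (d' : measure_display) (T' : measurableType d')
         (P' : probability T' R) (Y : T' -> path01 R),
    weakly_converges P (quantile_process F0 Fm) P' Y.

(* Assumption Q', for the estimator Gm of G^-1(p) derived from Fm. *)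
Definition assumption_Q' (F0 : R -> R) (p : R) (Gm : statistic) : Prop :=
  exists2 Fm : R -> statistic, estimates_F0_quantile_process F0 Fm &
    Gm = standardized_statistic (Fm p).

End QuantileEstimation.

(* Main.v *)
Require Import Defs.
From HB Require Import structures.
From mathcomp Require Import all_boot all_order all_algebra.
From mathcomp Require Import all_classical all_reals all_analysis.
From mathcomp Require Import measurable_realfun.
From mathcomp Require Import ring lra.

(* Since tau = mu + sigma q with q = G^-1(p), each component of the remainder is
     sqrt (n / m) * [(mean X - mu) * sqrt m (1/S - 1/sigma) + sqrt m (g - sigma q / S)],
   where S and g are computed from the additional sample of size m.  As n / m
   tends to 0, it suffices that every term between brackets is bounded in
   probability.  For mean X - mu, apply Markov's inequality to the average of the
   (X_i - mu)^2.  For sqrt m (S^2 - sigma^2), hence for sqrt m (1/S - 1/sigma),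
   apply it to squared sums of uncorrelated terms, whose second moments are finite
   because the fourth moment of F is.  The last term is
   sqrt m (g - q) up to a multiple of the previous one, or, when g is derived from
   an estimator f of the quantile q_0 = q sigma + mu + Delta of F_0, it is
     sqrt m [(f - q_0) - (mean X_0 - mu - Delta)] / S;
   convergence in distribution yields tightness of sqrt m (g - q) or
   sqrt m (f - q_0), for processes through the evaluation at p. *)

Set Implicit Arguments.
Unset Strict Implicit.
Unset Printing Implicit Defensive.

Import Order.TTheory GRing.Theory Num.Theory.
Import numFieldNormedType.Exports.

Local Open Scope classical_set_scope.
Local Open Scope ring_scope.

(** * Tail events and boundedness in probability *)

Lemma measurable_normr_gt {d : measure_display} {T : measurableType d} {R : realType}
    (Z : T -> R) (M : R) :
  measurable_fun setT Z -> measurable [set w | M < `|Z w|].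
Proof.
move=> mZ; rewrite (_ : [set _ | _] = (fun w => `|Z w|) @^-1` `]M, +oo[%classic).
  by rewrite -[X in measurable X]setTI; exact: measurableT_comp.
by apply/seteqP; split => w /=; rewrite in_itv/= andbT.
Qed.

Lemma measurable_normr_ge {d : measure_display} {T : measurableType d} {R : realType}
    (Z : T -> R) (M : R) :
  measurable_fun setT Z -> measurable [set w | M <= `|Z w|].
Proof.
move=> mZ; rewrite (_ : [set _ | _] = (fun w => `|Z w|) @^-1` `[M, +oo[%classic).
  by rewrite -[X in measurable X]setTI; exact: measurableT_comp.
by apply/seteqP; split => w /=; rewrite in_itv/= andbT.
Qed.

Section StochasticallyBounded.
Context {d : measure_display} {T : measurableType d} {R : realType}.
Variable P : probability T R.

(* The exceptional event A spares any measurability requirement on Z. *)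
Definition stochastically_bounded (Z : nat -> T -> R) : Prop :=
  forall e : R, 0 < e -> exists M : R, \forall k \near \oo,
    exists A, [/\ measurable A, (P A <= e%:E)%E &
      forall w, ~ A w -> `|Z k w| <= M].

Local Notation OP := stochastically_bounded.

Lemma stochastically_bounded_cst (c : R) : OP (fun _ _ => c).
Proof.
move=> e e0; exists `|c|; apply: nearW => k; exists set0.
by rewrite measure0 lee_fin (ltW e0); split.
Qed.

Lemma stochastically_bounded_le (Z Z' : nat -> T -> R) :
  (\forall k \near \oo, forall w, `|Z k w| <= `|Z' k w|) -> OP Z' -> OP Z.
Proof.
move=> ZZ' OZ' e /OZ'[M HM]; exists M; near=> k.
have [A [mA PA AM]] : exists A, [/\ measurable A, (P A <= e%:E)%E &
  forall w, ~ A w -> `|Z' k w| <= M] by near: k.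
exists A; split => // w /AM; apply: le_trans.
by move: w; near: k.
Unshelve. all: by end_near. Qed.

(** Each of the two bounds is granted [e / 2], so that the union of the exceptional events costs at
    most [e]; outside it [bd] controls [op]. *)
Let stochastically_bounded2 (op : R -> R -> R) (bd : R -> R -> R)
    (Z Z' : nat -> T -> R) :
  (forall x y a b, `|x| <= a -> `|y| <= b -> `|op x y| <= bd a b) ->
  OP Z -> OP Z' -> OP (fun k w => op (Z k w) (Z' k w)).
Proof.
move=> opbd OZ OZ' e e0; have e20 : 0 < e / 2 by rewrite divr_gt0.
have [M HM] := OZ _ e20; have [M' HM'] := OZ' _ e20.
exists (bd M M'); near=> k.
have [A [mA PA AM]] : exists A, [/\ measurable A, (P A <= (e / 2)%:E)%E &
  forall w, ~ A w -> `|Z k w| <= M] by near: k.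
have [A' [mA' PA' AM']] : exists A, [/\ measurable A, (P A <= (e / 2)%:E)%E &
  forall w, ~ A w -> `|Z' k w| <= M'] by near: k.
exists (A `|` A'); split; first exact: measurableU.
- apply: (le_trans (measureU2 _ _ _)) => //.
  by rewrite [e]splitr EFinD leeD.
- by move=> w /not_orP[/AM ? /AM' ?]; exact: opbd.
Unshelve. all: by end_near. Qed.

Lemma stochastically_boundedD (Z Z' : nat -> T -> R) :
  OP Z -> OP Z' -> OP (fun k w => Z k w + Z' k w).
Proof.
apply: (stochastically_bounded2 (bd := +%R)) => x y a b xa yb.
by rewrite (le_trans (ler_normD _ _))// lerD.
Qed.

Lemma stochastically_boundedM (Z Z' : nat -> T -> R) :
  OP Z -> OP Z' -> OP (fun k w => Z k w * Z' k w).
Proof.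
apply: (stochastically_bounded2 (bd := *%R)) => x y a b xa yb.
by rewrite normrM ler_pM.
Qed.

Lemma stochastically_bounded_comp (Z : nat -> T -> R) (m : nat -> nat) :
  m k @[k --> \oo] --> \oo -> OP Z -> OP (fun k => Z (m k)).
Proof. by move=> moo OZ e /OZ[M HM]; exists M; exact: (moo _ HM). Qed.

(** Off the exceptional event, [Z n] is within M / sqrt n of [c]; once this is at most [c / 2],
    [Z n] stays above [c / 2] and its inverse below [2 / c]. *)
Lemma stochastically_bounded_inv (Z : nat -> T -> R) (c : R) :
  0 < c -> OP (fun n w => Num.sqrt n%:R * (Z n w - c)) ->
  OP (fun n w => (Z n w)^-1).
Proof.
move=> c0 OZ e /OZ[M HM]; exists (2 / c); near=> n.
have [A [mA PA AM]] : exists A, [/\ measurable A, (P A <= e%:E)%E &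
  forall w, ~ A w -> `|Num.sqrt n%:R * (Z n w - c)| <= M] by near: n.
exists A; split => // w /AM; rewrite normrM ger0_norm ?sqrtr_ge0// => ZM.
have sn0 : 0 < Num.sqrt n%:R :> R.
  by rewrite sqrtr_gt0 ltr0n; near: n; exists 1%N.
have snM : 2 * M / c <= Num.sqrt n%:R :> R.
  (* [M] may be negative, whereas the comparison of squares needs a nonnegative left side. *)
  have [M0|M0] := leP (2 * M / c) 0; first by rewrite (le_trans M0)// sqrtr_ge0.
  rewrite -[leLHS]ger0_norm ?(ltW M0)// -sqrtr_sqr ler_wsqrtr//.
  by near: n; exact: nbhs_infty_ger.
have Zc : `|Z n w - c| <= c / 2.
  rewrite -(ler_pM2l sn0) (le_trans ZM)//.
  by move: snM; rewrite ler_pdivrMr// => ?; lra.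
have Zc2 : c / 2 <= Z n w by move: Zc; rewrite ler_norml => /andP[? ?]; lra.
have c20 : 0 < c / 2 by rewrite divr_gt0.
rewrite ger0_norm ?invr_ge0 ?(le_trans (ltW c20))//.
by rewrite -[leRHS]invf_div lef_pV2// posrE (lt_le_trans c20).
Unshelve. all: by end_near. Qed.

Lemma stochastically_bounded_markov (Z : nat -> T -> R) (C : R) :
  (forall k, measurable_fun setT (Z k)) ->
  (\forall k \near \oo, (\int[P]_w (`|Z k w|)%:E <= C%:E)%E) -> OP Z.
Proof.
(* Markov's inequality bounds the tail by [C] over the threshold, that is C e / (|C| + 1) <= e; the
   added 1 keeps the threshold positive when [C = 0]. *)
move=> mZ ZC e e0; exists ((`|C| + 1) / e); near=> k.
set M := (_ + 1) / e; have M0 : 0 < M by rewrite divr_gt0// ltr_pwDr.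
have mA : measurable [set w | M <= `|Z k w|] by exact: measurable_normr_ge.
exists [set w | M <= `|Z k w|]; split => //; last first.
  by move=> w /= /negP; rewrite -ltNge => /ltW.
have MP : (M%:E * P [set w | (M <= `|Z k w|)%R] <= C%:E)%E.
  rewrite -integral_cst//; apply: (@le_trans _ _ (\int[P]_w (`|Z k w|)%:E)%E).
    apply: (@le_trans _ _
      (\int[P]_(w in [set w | (M <= `|Z k w|)%R]) (`|Z k w|)%:E)%E).
      apply: ge0_le_integral => //=.
      - by move=> *; rewrite lee_fin ltW.
      - apply/measurable_EFinP; apply: measurableT_comp => //.
        exact: measurable_funTS.
    apply: ge0_subset_integral => //=.
    by apply/measurable_EFinP; exact: measurableT_comp.
  by near: k.
have PAf : P [set w | M <= `|Z k w|] \is a fin_num by rewrite fin_num_measure.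
move: MP; rewrite -(fineK PAf) -EFinM !lee_fin -ler_pdivlMl// => /le_trans; apply.
rewrite /M invf_div mulrAC ler_pdivrMr ?ltr_pwDr// ler_pM2l//.
by rewrite (le_trans (ler_norm _))// lerDl.
Unshelve. all: by end_near. Qed.

(** Outside an event of probability at most [eta], |Z k| <= M; eventually |a k| <= e / (|M| + 1), so
    the tail event of the product lies inside that exceptional event. *)
Lemma stochastically_bounded_oP (Z : nat -> T -> R) (a : nat -> R) :
  a k @[k --> \oo] --> 0 -> OP Z ->
  (forall k, measurable_fun setT (Z k)) ->
  forall e : R, 0 < e ->
  P [set w | e < `|a k * Z k w|] @[k --> \oo] --> 0%E.
Proof.
move=> a0 OZ mZ e e0.
have mA k : measurable [set w | e < `|a k * Z k w|].
  by apply: measurable_normr_gt; exact: measurable_funM.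
apply/fine_cvgP; split; first by apply: nearW => k; rewrite fin_num_measure.
apply/cvgrPdist_le => eta eta0 /=.
have [M HM] := OZ _ eta0.
near=> k.
have [A [mA' PA AM]] : exists A, [/\ measurable A, (P A <= eta%:E)%E &
  forall w, ~ A w -> `|Z k w| <= M] by near: k.
rewrite sub0r normrN ger0_norm ?fine_ge0// -lee_fin fineK ?fin_num_measure//.
apply: le_trans PA; apply: le_measure; rewrite ?inE// => w /=.
apply: contraPP => /AM ZM; apply/negP; rewrite -leNgt normrM.
have ak : `|a k| <= e / (`|M| + 1).
  near: k; have := a0; move/cvgrPdist_le => /(_ (e / (`|M| + 1))) /=.
  rewrite divr_gt0 ?ltr_pwDr// => /(_ isT).
  by apply: filterS => k; rewrite sub0r normrN.
rewrite (@le_trans _ _ (e / (`|M| + 1) * (`|M| + 1)))//.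
  apply: ler_pM => //; rewrite (le_trans ZM)// (le_trans (ler_norm _))//.
  by rewrite lerDl.
by rewrite divfK// gt_eqF// ltr_pwDr.
Unshelve. all: by end_near. Qed.

End StochasticallyBounded.

(** * Integrability, independence and variances of sums *)

Section Moments.
Context {d : measure_display} {T : measurableType d} {R : realType}.
Variable P : probability T R.

Lemma Lfun2_sqr (f : T -> R) : measurable_fun setT f ->
  (\int[P]_w (f w ^+ 2)%:E < +oo)%E -> f \in Lfun P 2%:E.
Proof.
move=> mf f2; apply/andP; split; rewrite inE//=.
rewrite /finite_norm unlock poweR_lty//.
apply: le_lt_trans f2; apply: ge0_le_integral => //=.
- apply/measurable_EFinP.
  apply: (@measurableT_comp _ _ _ _ _ _ (fun x : R => x `^ 2)%R) => //.
  exact: measurableT_comp.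
- by apply/measurable_EFinP; exact: measurable_funX.
- by move=> t _; rewrite lee_fin powR_mulrn// -normrX ger0_norm ?sqr_ge0.
Qed.

Lemma distribution_integrable (X : {RV P >-> R}) :
  (X : T -> R) \in Lfun P 1 -> (distribution P X).-integrable setT EFin.
Proof.
move=> /Lfun1_integrable X1.
exact: (integrable_pushforward (measurable_funPT X)).
Qed.

Lemma distribution_expectation (X : {RV P >-> R}) :
  (X : T -> R) \in Lfun P 1 -> (\int[distribution P X]_x x%:E = 'E_P[X])%E.
Proof.
by move=> /Lfun1_integrable X1; rewrite integral_distribution// expectation_def.
Qed.

(** On rectangles the law of the pair is the product of the marginal laws; by uniqueness of the
    product measure it is so everywhere, and Fubini's theorem factors the integral. *)
Lemma expectation_independent (X Y : {RV P >-> R}) :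
  (forall A B : set R, measurable A -> measurable B ->
     P (X @^-1` A `&` Y @^-1` B) = (P (X @^-1` A) * P (Y @^-1` B))%E) ->
  (X : T -> R) \in Lfun P 1 -> (Y : T -> R) \in Lfun P 1 ->
  (X \* Y : T -> R) \in Lfun P 1 ->
  'E_P[(X : T -> R) \* Y]%E = ('E_P[X] * 'E_P[Y])%E.
Proof.
move=> XY X1 Y1 XY1.
have mXY : measurable_fun setT (fun w => (X w, Y w)).
  by apply: measurable_fun_pair.
pose XYm : {mfun T >-> (R * R)%type} := mfun_Sub (mem_set mXY).
have EXY : 'E_P[(X : T -> R) \* Y]%E =
    (\int[distribution P XYm]_z (z.1 * z.2)%:E)%E.
  rewrite integral_distribution//.
  - by rewrite unlock.
  - by apply/measurable_EFinP; exact: measurable_funM.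
  - exact/Lfun1_integrable.
pose mX := distribution P X; pose mY := distribution P Y.
have mprod : forall A, measurable A -> (mX \x mY)%E A = distribution P XYm A.
  by apply: product_measure_unique => A B mA mB; exact: XY.
have imul : (mX \x mY)%E.-integrable setT (fun z : R * R => (z.1 * z.2)%:E).
  have : (distribution P XYm).-integrable setT (fun z : R * R => (z.1 * z.2)%:E).
    apply: (integrable_pushforward mXY) => //.
      by apply/measurable_EFinP; exact: measurable_funM.
    exact/Lfun1_integrable.
  move/integrableP => [mxy ixy]; apply/integrableP; split => //.
  by rewrite (eq_measure_integral (distribution P XYm))// => A mA _; exact: mprod.
rewrite EXY.
rewrite (eq_measure_integral (mX \x mY)%E); last by move=> A mA _; exact/esym/mprod.
rewrite -(integral12_prod_meas1 imul) /fubini_F/=.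
transitivity (\int[mX]_x (x%:E * 'E_P[Y]))%E.
  apply: eq_integral => x _; under eq_integral do rewrite EFinM.
  by rewrite integralZl ?distribution_integrable// distribution_expectation.
rewrite -(fineK (expectation_fin_num Y1)).
by rewrite integralZr ?distribution_integrable// distribution_expectation.
Qed.

(** By bilinearity of the covariance, each partial sum is uncorrelated with the terms that follow,
    so the cross term vanishes at every step of the induction. *)
Lemma variance_sum (W : nat -> T -> R) (n : nat) :
  (forall i, W i \in Lfun P 2%:E) ->
  (forall i j, i != j -> covariance P (W i) (W j) = 0%E) ->
  'V_P[fun w => (\sum_(i < n) W i w)%R]%E = (\sum_(i < n) 'V_P[W i])%E.
Proof.
move=> W2 W0.
have P_fin : P setT \is a fin_num by rewrite fin_num_measure.
have sumE k : (fun w => \sum_(i < k) W i w : R) = \sum_(i < k) W i.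
  by apply/funext => w; rewrite fct_sumE.
have S2 k : \sum_(i < k) W i \in Lfun P 2%:E by rewrite rpred_sum// lee1n.
have cov0 k j : (k <= j)%N -> covariance P (\sum_(i < k) W i) (W j) = 0%E.
  elim: k => [|k IHk] kj; first by rewrite big_ord0 covariance_cst_l.
  rewrite big_ord_recr/= covarianceDl// ?IHk ?(ltnW kj)//; last exact: S2.
  by rewrite W0 ?adde0// ltn_eqF.
rewrite sumE; elim: n => [|n IHn].
  by rewrite !big_ord0 variance_cst.
rewrite !big_ord_recr/= -IHn varianceD//; last exact: S2.
by rewrite cov0// [X in (_ + X)%E]mule0 adde0.
Qed.

End Moments.

(** Lets a quantity be bounded through its square, whose expectation is computable. *)
Lemma norm_le_1Dsqr {R : realDomainType} (x : R) : `|x| <= 1 + x ^+ 2.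
Proof.
have := sqr_ge0 (x + 1); have := sqr_ge0 (x - 1).
by rewrite ler_norml => ? ?; apply/andP; split; nra.
Qed.

(** * Moments under a given distribution function *)

Section DistributionFunctions.
Context {d : measure_display} {T : measurableType d} {R : realType}.
Variable P : probability T R.

(* Stieltjes measures live on [measurableTypeR R], whose display is not that of
   [R] although the measurable sets are the same. *)
Let measurable_stieltjes (X : {RV P >-> R}) :
  @measurable_fun _ _ T (measurableTypeR R) setT X.
Proof. exact: measurable_funPT X. Qed.

Let stieltjes_RV (X : {RV P >-> R}) : {mfun T >-> measurableTypeR R} :=
  @mfun_Sub _ _ T (measurableTypeR R) X (mem_set (measurable_stieltjes X)).

(** Both measures give F b - F a to an interval ]a, b] with a <= b, and the values on such intervals
    determine the measure. *)
Let has_df_distribution (X : {RV P >-> R}) (F : cumulativeBounded (0 : R) (1 : R))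
    (A : set (measurableTypeR R)) :
  has_df X F -> measurable A ->
  distribution P (stieltjes_RV X) A = lebesgue_stieltjes_measure F A.
Proof.
move=> XF mA; apply/esym.
apply: (@lebesgue_stieltjes_measure_unique R F (distribution P (stieltjes_RV X))) => //.
move=> _ [[a b] _ <-] /=.
rewrite /lebesgue_stieltjes_measure /measure_extension/=.
rewrite measurable_mu_extE/=; last exact: is_ocitv.
have [ab|ba] := leP a b; last first.
  by rewrite set_itv_ge ?wlength0 ?measure0// bnd_simp -leNgt ltW.
rewrite wlength_itv_bnd// EFinB -!XF.
have -> : `]a, b]%classic = `]-oo, b] `\` `]-oo, a] :> set R.
  by rewrite -[RHS]setCK setCD setCitvl setUC -[LHS]setCK setCitv.
rewrite measureD ?setIidr//; first exact: subset_itvl.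
by rewrite -ge0_fin_numE// fin_num_measure.
Qed.

(** Nonnegativity allows infinite values, so that finiteness of a moment of [X] can be read off from
    [F]. *)
Lemma has_df_ge0_integral (X : {RV P >-> R}) (F : cumulativeBounded (0 : R) (1 : R))
    (g : R -> R) :
  has_df X F -> measurable_fun setT g -> (forall x, 0 <= g x) ->
  (\int[P]_w (g (X w))%:E = \int[lebesgue_stieltjes_measure F]_x (g x)%:E)%E.
Proof.
move=> XF mg g0.
transitivity (\int[distribution P (stieltjes_RV X)]_x (g x)%:E)%E; last first.
  by apply: eq_measure_integral => A mA _; exact: has_df_distribution.
by rewrite ge0_integral_distribution//; exact/measurable_EFinP.
Qed.

Lemma has_df_integral (X : {RV P >-> R}) (F : cumulativeBounded (0 : R) (1 : R))
    (g : R -> R) :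
  has_df X F -> measurable_fun setT g -> P.-integrable setT (fun w => (g (X w))%:E) ->
  (\int[P]_w (g (X w))%:E = \int[lebesgue_stieltjes_measure F]_x (g x)%:E)%E.
Proof.
move=> XF mg ig.
transitivity (\int[distribution P (stieltjes_RV X)]_x (g x)%:E)%E; last first.
  by apply: eq_measure_integral => A mA _; exact: has_df_distribution.
by rewrite integral_distribution//; exact/measurable_EFinP.
Qed.

(** For n >= 1 the squared normalized error has expectation [v - c ^+ 2], whatever n, because the
    terms are uncorrelated; Markov's inequality then applies. Used with [h] a centring and with [h]
    a squared deviation. *)
Lemma iid_mean_bounded (X : nat -> {RV P >-> R}) (h : R -> R) (c v : R) :
  mutually_independent P (fun i => sigma_RV (X i)) -> measurable_fun setT h ->
  (forall i, \int[P]_w (h (X i w))%:E = c%:E)%E ->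
  (forall i, \int[P]_w (h (X i w) ^+ 2)%:E = v%:E)%E ->
  stochastically_bounded P
    (fun n w => Num.sqrt n%:R * ((\sum_(i < n) h (X i w)) / n%:R - c)).
Proof.
move=> indX mh hc hv.
pose W i : T -> R := h \o X i.
have mW i : measurable_fun setT (W i) by exact: measurableT_comp.
have W2 i : W i \in Lfun P 2%:E by rewrite Lfun2_sqr// hv ltry.
have P_fin : P setT \is a fin_num by rewrite fin_num_measure.
have W1 i : W i \in Lfun P 1 by exact: Lfun_subset12.
have EW i : ('E_P[W i] = c%:E)%E by rewrite unlock hc.
have covW i j : i != j -> covariance P (W i) (W j) = 0%E.
  move=> ij; rewrite covarianceE ?Lfun2_mul_Lfun1//.
  pose Wm k : {RV P >-> R} := mfun_Sub (mem_set (mW k)).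
  have -> : ('E_P[W i * W j] = 'E_P[W i] * 'E_P[W j])%E.
    apply: (@expectation_independent _ _ _ _ (Wm i) (Wm j)); last 3 first.
    - exact: (W1 i).
    - exact: (W1 j).
    - exact: (Lfun2_mul_Lfun1 (W2 i) (W2 j)).
    move=> A B mA mB.
    (* Independence of the family is specialized to two indices, with events that lie in the
       sigma-algebras of [X i] and [X j] because [h] is measurable. *)
    have := indX [:: i; j]
      (fun k => if k == i then W i @^-1` A else W j @^-1` B).
    rewrite !big_cons big_nil eqxx eq_sym (negbTE ij) mule1/= inE ij => <- //.
      rewrite bigcap_seq/= !big_cons big_nil eqxx eq_sym (negbTE ij) setIT//.
    move=> k; rewrite !inE => /orP[|] /eqP ->.
      rewrite eqxx; exists (h @^-1` A) => //.
      by rewrite -[X in measurable X]setTI; exact: mh.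
    rewrite eq_sym (negbTE ij); exists (h @^-1` B) => //.
    by rewrite -[X in measurable X]setTI; exact: mh.
  by rewrite !EW subee.
have VW i : ('V_P[W i] = (v - c ^+ 2)%:E)%E.
  by rewrite varianceE// EW unlock/= hv.
pose S n : T -> R := fun w => \sum_(i < n) W i w.
have S1 n : S n \in Lfun P 1.
  rewrite (_ : S n = \sum_(i < n) W i) ?rpred_sum//.
  by apply/funext => w; rewrite fct_sumE.
have ES n : ('E_P[S n] = (c *+ n)%:E)%E.
  elim: n => [|n IHn].
    rewrite (_ : S 0 = cst 0) ?expectation_cst//.
    by apply/funext => w; rewrite /S big_ord0.
  rewrite (_ : S n.+1 = S n \+ W n); last first.
    by apply/funext => w; rewrite /S big_ord_recr.
  by rewrite expectationD// IHn EW mulrSr.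
have VS n : ('V_P[S n] = ((v - c ^+ 2) *+ n)%:E)%E.
  rewrite variance_sum//; under eq_bigr do rewrite VW.
  by rewrite sumEFin sumr_const card_ord.
have mS n : measurable_fun setT (S n) by exact: measurable_sum.
apply: (@stochastically_bounded_le _ _ _ _ _
    (fun n w => 1 + (Num.sqrt n%:R * (S n w / n%:R - c)) ^+ 2)).
  apply: nearW => n w; rewrite -/(S n w) [leRHS]ger0_norm ?addr_ge0 ?sqr_ge0//.
  exact: norm_le_1Dsqr.
apply: stochastically_boundedD; first exact: stochastically_bounded_cst.
apply: (@stochastically_bounded_markov _ _ _ _ _ (v - c ^+ 2)).
  move=> n; apply: measurable_funX; apply: measurable_funM => //.
  by apply: measurable_funB => //; apply: measurable_funM.
exists 1%N => //= n n0.
have {}n0 : n%:R != 0 :> R by rewrite pnatr_eq0 -lt0n.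
have := VS n; rewrite /variance covariance.unlock ES expectation.unlock/= => VSn.
(* The square equals (S n - n c)^2 / n, so its integral is the variance of [S n] divided by n. *)
under eq_integral => w _.
  rewrite ger0_norm ?sqr_ge0// (_ : _ ^+ 2 =
    n%:R^-1 * ((S n w - c *+ n) * (S n w - c *+ n))).
    rewrite EFinM; over.
  by rewrite exprMn sqr_sqrtr ?ler0n// -mulr_natr; field.
rewrite /= ge0_integralZl_EFin//.
- by rewrite [X in (_ * X)%E]VSn -EFinM lee_fin -[(_ - _) *+ n]mulr_natl mulKf.
- by move=> w _; rewrite lee_fin -expr2 sqr_ge0.
- apply/measurable_EFinP.
  by apply: measurable_funM; apply: measurable_funB.
Qed.

End DistributionFunctions.

(** * Quantiles under affine changes of variable *)

Section Quantiles.
Context {R : realType}.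

(** The limit of [F] at +oo makes the set nonempty and the limit at -oo bounds it below, so that
    [inf] is a genuine infimum and not a default value. *)
Let superlevel_has_inf (F : cumulativeBounded (0 : R) (1 : R)) (p : R) :
  0 < p < 1 -> has_inf [set x | p <= F x].
Proof.
move=> /andP[p0 p1]; split.
  have /cvgrPdist_lt /(_ (1 - p)) := cumulativey F; rewrite subr_gt0 p1.
  move=> /(_ isT) [M [_ HM]]; exists (M + 1); rewrite /=.
  have := HM (M + 1); rewrite ltrDl ltr01 => /(_ isT).
  by rewrite /= ltr_norml => /andP[_]; lra.
have /cvgrPdist_lt /(_ p p0) [M [_ HM]] := cumulativeNy F.
exists M => x /= pFx; rewrite leNgt; apply/negP => /HM.
by rewrite /= sub0r normrN => /(le_lt_trans (ler_norm _)); rewrite ltNge pFx.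
Qed.

(** The increasing map x -> a x + b carries one superlevel set onto the other, hence one infimum to
    the other. Used with [sigma], [mu] and with 1, [Delta]. *)
Lemma quantile_affine (F : cumulativeBounded (0 : R) (1 : R)) (a b p : R) :
  0 < a -> 0 < p < 1 ->
  quantile (fun x => F ((x - b) / a)) p = a * quantile F p + b.
Proof.
move=> a0 p01; rewrite /quantile.
have [[x0 /= Fx0] lbF] := superlevel_has_inf F p01.
have E x : (a * x + b - b) / a = x by rewrite addrK mulrC mulKf// gt_eqF.
apply/eqP; rewrite eq_le; apply/andP; split; last first.
  apply: lb_le_inf; first by exists (a * x0 + b); rewrite /= E.
  move=> y /= Fy; rewrite -lerBrDr mulrC -ler_pdivlMr//.
  exact: ge_inf.
rewrite -lerBlDr mulrC -ler_pdivrMr//.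
apply: lb_le_inf; first by exists x0.
move=> y /= Fy; rewrite ler_pdivrMr// lerBlDr.
have [l lF] := lbF.
apply: ge_inf; last by rewrite /= (mulrC y) E.
exists (a * l + b) => z /= Fz; rewrite -lerBrDr mulrC -ler_pdivlMr//.
exact: lF.
Qed.

End Quantiles.

(** * Algebra of sample means and standard deviations *)

Section SampleMoments.
Context {R : realType}.

(** Replaces the random centre by a constant, so that the sample variance is expressed through two
    averages of functions of single observations. *)
Lemma sample_sd_sqr (n : nat) (x : n.-tuple R) (c : R) : (1 < n)%N ->
  sample_sd x ^+ 2 =
  ((\sum_(i < n) (tnth x i - c) ^+ 2) - n%:R * (sample_mean x - c) ^+ 2) / n.-1%:R.
Proof.
move=> n1; rewrite /sample_sd sqr_sqrtr; last first.
  by rewrite divr_ge0// sumr_ge0// => i _; exact: sqr_ge0.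
have n0 : n%:R != 0 :> R by rewrite pnatr_eq0 -lt0n ltnW.
congr (_ / _); set m := sample_mean x.
have mE : n%:R * m = \sum_(i < n) tnth x i by rewrite /m /sample_mean mulrC divfK.
(* Difference of squares: (x - c)^2 - (x - m)^2 = (m - c)(2 x - m - c). *)
transitivity (\sum_(i < n) ((tnth x i - c) ^+ 2 - (m - c) * (2 * tnth x i - m - c))).
  by apply: eq_bigr => i _; ring.
rewrite big_split/= sumrN -mulr_sumr; congr (_ - _).
rewrite !big_split/= -mulr_sumr -mE !sumr_const card_ord.
rewrite -[- m *+ n]mulr_natl -[- c *+ n]mulr_natl.
by ring.
Qed.

(** Triangle inequality, then [norm_le_1Dsqr] term by term; second moments thus control the mean. *)
Lemma sample_mean_dist (n : nat) (x : n.-tuple R) (c : R) : (0 < n)%N ->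
  `|sample_mean x - c| <= 1 + (\sum_(i < n) (tnth x i - c) ^+ 2) / n%:R.
Proof.
move=> n0; have n0' : 0 < n%:R :> R by rewrite ltr0n.
have -> : sample_mean x - c = (\sum_(i < n) (tnth x i - c)) / n%:R.
  rewrite /sample_mean big_split/= sumr_const card_ord mulrDl.
  rewrite -[- c *+ n]mulr_natr mulfK//.
  by rewrite gt_eqF.
rewrite normrM (ger0_norm (x := n%:R^-1)) ?invr_ge0 ?ler0n//.
rewrite ler_pdivrMr// mulrDl divfK ?gt_eqF// mul1r.
apply: (le_trans (ler_norm_sum _ _ _)).
have -> : n%:R = \sum_(i < n) 1 :> R by rewrite sumr_const card_ord.
rewrite -big_split/=; apply: ler_sum => i _.
exact: norm_le_1Dsqr.
Qed.

End SampleMoments.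

(** * Stochastic bounds for sample statistics *)

Section SampleStatistics.
Context {d : measure_display} {T : measurableType d} {R : realType}.
Variable P : probability T R.
Local Notation OP := (stochastically_bounded P).

(** With r = sqrt n and [A], [B] the two normalized errors, the decomposition of S^2 about [c] gives
    r (S^2 - s^2) = r^2 / (r^2 - 1) A - r / (r^2 - 1) B^2 + r / (r^2 - 1) s^2. *)
Lemma sample_sd_bounded (X : nat -> {RV P >-> R}) (c s : R) : 0 < s ->
  OP (fun n w => Num.sqrt n%:R * ((\sum_(i < n) (X i w - c) ^+ 2) / n%:R - s ^+ 2)) ->
  OP (fun n w => Num.sqrt n%:R * (sample_mean (sample X n w) - c)) ->
  OP (fun n w => Num.sqrt n%:R * (sample_sd (sample X n w) - s)).
Proof.
move=> s0 OA OB.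
pose A n w := Num.sqrt n%:R * ((\sum_(i < n) (X i w - c) ^+ 2) / n%:R - s ^+ 2).
pose B n w := Num.sqrt n%:R * (sample_mean (sample X n w) - c).
(* The 2 bounds both r^2 / (r^2 - 1) and r / (r^2 - 1) for n >= 2; the division by [s] passes from
   S^2 - s^2 to S - s, since S + s >= s. *)
apply: (@stochastically_bounded_le _ _ _ _ _ (fun n w =>
    (`|A n w| + B n w * B n w + s ^+ 2) * (2 / s))); last first.
  apply: stochastically_boundedM; last exact: stochastically_bounded_cst.
  apply: stochastically_boundedD; last exact: stochastically_bounded_cst.
  apply: stochastically_boundedD; last exact: stochastically_boundedM.
  apply: stochastically_bounded_le OA; apply: nearW => n w.
  by rewrite normr_id.
exists 2%N => //= n /= n2 w.
have n0 : (0 < n)%N by rewrite ltnW.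
set S := sample_sd _.
have S0 : 0 <= S by rewrite sqrtr_ge0.
have N2 : 2 <= n%:R :> R by rewrite ler_nat.
have N1E : n.-1%:R = n%:R - 1 :> R by rewrite -subn1 natrB.
have r0 : 0 < Num.sqrt n%:R :> R by rewrite sqrtr_gt0 ltr0n.
have rr : Num.sqrt n%:R ^+ 2 = n%:R :> R by rewrite sqr_sqrtr ?ler0n.
have := sample_sd_sqr (sample X n w) c n2; rewrite -/S N1E.
have -> : sample_mean (sample X n w) - c = B n w / Num.sqrt n%:R.
  by rewrite /B mulrC mulKf// gt_eqF.
have -> : \sum_(i < n) (tnth (sample X n w) i - c) ^+ 2 =
    n%:R * (s ^+ 2 + A n w / Num.sqrt n%:R).
  rewrite /A [X in X / Num.sqrt _]mulrC mulfK ?gt_eqF// addrC subrK.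
  rewrite mulrC divfK ?pnatr_eq0 -?lt0n//.
  by apply: eq_bigr => i _; rewrite tnth_mktuple.
move: r0 rr N2 S0.
move: (A n w) (B n w) (n%:R) (Num.sqrt n%:R) S => A' B' N r S r0 <- N2 S0 SE.
have N1 : 0 < r ^+ 2 - 1 by lra.
have {}SE : r * (S ^+ 2 - s ^+ 2) = (r ^+ 2 / (r ^+ 2 - 1)) * A'
    - r / (r ^+ 2 - 1) * (B' * B') + r / (r ^+ 2 - 1) * s ^+ 2.
  rewrite SE; field; apply/andP; split; rewrite gt_eqF//.
have q1 : r ^+ 2 / (r ^+ 2 - 1) <= 2 by rewrite ler_pdivrMr//; lra.
have q2 : r / (r ^+ 2 - 1) <= 2 by rewrite ler_pdivrMr//; nra.
have q10 : 0 <= r ^+ 2 / (r ^+ 2 - 1) by rewrite divr_ge0 ?sqr_ge0 ?ltW.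
have q20 : 0 <= r / (r ^+ 2 - 1) by rewrite divr_ge0 ?ltW.
rewrite [leRHS]ger0_norm; last first.
  rewrite mulr_ge0 ?divr_ge0 ?(ltW s0)// addr_ge0 ?sqr_ge0//.
  by rewrite addr_ge0 ?normr_ge0// -expr2 sqr_ge0.
rewrite mulrA ler_pdivlMr//.
apply: (@le_trans _ _ (`|r * (S ^+ 2 - s ^+ 2)|)).
  rewrite subr_sqr !normrM mulrA ler_wpM2l// ?mulr_ge0//.
  by rewrite ger0_norm ?lerDr// addr_ge0// ltW.
rewrite SE; apply: (le_trans (ler_normD _ _)); rewrite mulrDl; apply: lerD.
  apply: (le_trans (ler_normB _ _)); rewrite mulrDl; apply: lerD.
    by rewrite normrM mulrC (ger0_norm q10) ler_wpM2l.
  by rewrite normrM mulrC (ger0_norm q20) ger0_norm -expr2 ?sqr_ge0// ler_wpM2l ?sqr_ge0.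
by rewrite normrM mulrC (ger0_norm q20) ger0_norm ?sqr_ge0// ler_wpM2l ?sqr_ge0.
Qed.

(** The observations may change with [k], as in a triangular array. The average squared deviation
    has expectation [v] for every [k], so Markov's inequality applies; no rate is claimed, as the
    decay of the remainder comes from the factor sqrt (n / m). *)
Lemma sample_mean_bounded (X : nat -> nat -> {RV P >-> R}) (n : nat -> nat) (c v : R) :
  (forall k, (0 < n k)%N) ->
  (forall k i, (i < n k)%N -> \int[P]_w ((X k i w - c) ^+ 2)%:E = v%:E)%E ->
  OP (fun k w => sample_mean (sample (X k) (n k) w) - c).
Proof.
move=> n0 Xv.
pose Z k w := (\sum_(i < n k) (X k i w - c) ^+ 2) / (n k)%:R.
have Z0 k w : 0 <= Z k w by rewrite divr_ge0// sumr_ge0// => i _; exact: sqr_ge0.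
have mX k i : measurable_fun setT (fun w => (X k i w - c) ^+ 2).
  by apply: measurable_funX; exact: measurable_funB.
apply: (@stochastically_bounded_le _ _ _ _ _ (fun k w => 1 + Z k w)).
  apply: nearW => k w; rewrite [leRHS]ger0_norm ?addr_ge0//.
  apply: (le_trans (sample_mean_dist _ _ _)) => //.
  by rewrite lerD2l ler_pM2r ?invr_gt0 ?ltr0n// ler_sum// => i _; rewrite tnth_mktuple.
apply: stochastically_boundedD; first exact: stochastically_bounded_cst.
apply: (@stochastically_bounded_markov _ _ _ _ _ v).
  by move=> k; apply: measurable_funM => //; exact: measurable_sum.
apply: nearW => k.
under eq_integral => w _ do rewrite ger0_norm// /Z mulrC EFinM -sumEFin.
rewrite ge0_integralZl_EFin//=; last 2 first.
- by move=> w _; rewrite sume_ge0// => i _; rewrite lee_fin sqr_ge0.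
- by apply: emeasurable_sum => i; apply/measurable_EFinP.
rewrite ge0_integral_sum//; last 2 first.
- by move=> i; apply/measurable_EFinP.
- by move=> i w _; rewrite lee_fin sqr_ge0.
under eq_bigr => i _ do rewrite Xv//.
rewrite sumEFin sumr_const card_ord -EFinM lee_fin -[v *+ _]mulr_natl mulKf//.
by rewrite pnatr_eq0 -lt0n.
Qed.

End SampleStatistics.

(** * Tightness from convergence in distribution *)

Section Tightness.
Context {d : measure_display} {T : measurableType d} {R : realType}.
Variable P : probability T R.

(* A continuous bounded test function squeezed between the indicators of
   [M + 1 <= |x|] and [M < |x|]. *)
Definition ramp (M : R) : R -> R := cst 1 \min (cst 0 \max (fun x => `|x| - M)).

Lemma ramp_ge0 M x : 0 <= ramp M x.
Proof. by rewrite /ramp/= le_min ler01 le_max lexx. Qed.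

Lemma ramp_le1 M x : ramp M x <= 1.
Proof. by rewrite /ramp/= ge_min lexx. Qed.

Lemma ramp1 M x : M + 1 <= `|x| -> ramp M x = 1.
Proof.
move=> Mx; apply/eqP; rewrite eq_le ramp_le1/= /ramp/= le_min lexx/= le_max.
by rewrite lerBrDr addrC Mx orbT.
Qed.

Lemma ramp0 M x : `|x| <= M -> ramp M x = 0.
Proof.
move=> xM; apply/eqP; rewrite eq_le ramp_ge0 andbT /ramp/= ge_min ge_max lexx/=.
by rewrite subr_le0 xM orbT.
Qed.

Lemma continuous_ramp M : continuous (ramp M).
Proof.
move=> x; apply: continuous_min; first exact: cvg_cst.
apply: continuous_max; first exact: cvg_cst.
by apply: cvgB; [exact: norm_continuous|exact: cvg_cst].
Qed.

(** The events |V| > n decrease to the empty set, so their probabilities vanish, and the ramp at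
    level n is at most the indicator of such an event. *)
Lemma ramp_expectation_small {d' : measure_display} {T' : measurableType d'}
    (P' : probability T' R) (V : {RV P' >-> R}) (e : R) : 0 < e ->
  exists M : R, ('E_P'[ramp M \o V] < e%:E)%E.
Proof.
move=> e0.
pose A n := [set w | n%:R < `|V w|].
have mA n : measurable (A n) by exact: measurable_normr_gt.
have A0 : \bigcap_n A n = set0.
  rewrite -subset0 => w Aw; have := Aw (Num.truncn `|V w|).+1 I.
  by rewrite /A/= ltNge ltW// truncnS_gt.
have : P' \o A @ \oo --> P' (\bigcap_n A n).
  apply: nonincreasing_cvg_mu => //.
  - by rewrite (le_lt_trans (probability_le1 _ _))// ltry.
  - by rewrite A0.
  - move=> m n mn; apply/subsetPset => w; apply: le_lt_trans.
    by rewrite ler_nat.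
rewrite A0 measure0 => /(_ _ (@open_ereal_lt' _ 0%E e%:E _)).
rewrite lte_fin e0 => /(_ isT) [N _ HN].
exists N%:R; apply: le_lt_trans (HN N (leqnn _)).
rewrite [leRHS](_ : _ = 'E_P'[\1_(A N)])%E; last by rewrite expectation_indic.
apply: expectation_le => //.
- apply: measurableT_comp => //; apply: continuous_measurable_fun.
  exact: continuous_ramp.
- by move=> w; exact: ramp_ge0.
- apply: aeW => w /=; rewrite indicE.
  have [/set_mem _|/negP Aw] := boolP (w \in A N); first exact: ramp_le1.
  by rewrite ramp0// leNgt; apply/negP => ?; apply: Aw; rewrite inE.
Qed.

(** [u] stands for an expectation or an outer expectation, so that one argument serves both modes of
    convergence: it dominates the tail and is eventually below [e] as soon as its limit is. *)
Lemma ramp_tight (Z : nat -> T -> R) (u : R -> nat -> \bar R)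
    {d' : measure_display} {T' : measurableType d'}
    (P' : probability T' R) (V : {RV P' >-> R}) :
  (forall n, measurable_fun setT (Z n)) ->
  (forall M n, P [set w | (M + 1 <= `|Z n w|)%R] <= u M n)%E ->
  (forall M, u M n @[n --> \oo] --> 'E_P'[ramp M \o V]%E) ->
  stochastically_bounded P Z.
Proof.
move=> mZ Pu uV e e0.
have [M HM] := ramp_expectation_small V e0.
exists (M + 1).
have : \forall n \near \oo, (u M n < e%:E)%E by exact: (uV M _ (open_ereal_lt' HM)).
apply: filterS => n une.
exists [set w | M + 1 <= `|Z n w|]; split.
- exact: measurable_normr_ge.
- by rewrite (le_trans (Pu _ _))// ltW.
- by move=> w /= /negP; rewrite -ltNge => /ltW.
Qed.

(** [Y] is the ramp itself for ordinary expectations, and an arbitrary competitor in the infimum for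
    outer ones. *)
Let tail_le_expectation (Z Y : T -> R) (M : R) :
  measurable_fun setT Z -> measurable_fun setT Y ->
  (forall w, ramp M (Z w) <= Y w) ->
  (P [set w | (M + 1 <= `|Z w|)%R] <= 'E_P[Y])%E.
Proof.
move=> mZ mY ZY.
have mA := measurable_normr_ge (M + 1) mZ.
rewrite -expectation_indic//; apply: expectation_le => //.
- by move=> w; rewrite (le_trans (ramp_ge0 M (Z w))).
- apply: aeW => w /=; apply: le_trans (ZY w); rewrite indicE.
  have [/set_mem Zw|_] := boolP (_ \in _); last exact: ramp_ge0.
  by rewrite ramp1.
Qed.

Let ramp_bounded M : bounded_fun (ramp M).
Proof.
exists 1; split=> // x x1 y _; rewrite /= ger0_norm ?ramp_ge0//.
by rewrite (le_trans (ramp_le1 _ _))// ltW.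
Qed.

Lemma converges_in_distribution_bounded (Z : nat -> T -> R)
    {d' : measure_display} {T' : measurableType d'}
    (P' : probability T' R) (V : {RV P' >-> R}) :
  (forall n, measurable_fun setT (Z n)) ->
  converges_in_distribution P Z V -> stochastically_bounded P Z.
Proof.
move=> mZ ZV; apply: (@ramp_tight Z (fun M n => 'E_P[ramp M \o Z n]%E) _ _ _ V) => //.
  move=> M n; apply: tail_le_expectation => //; apply: measurableT_comp => //.
  by apply: continuous_measurable_fun; exact: continuous_ramp.
by move=> M; apply: ZV; [exact: continuous_ramp|exact: ramp_bounded].
Qed.

(** The singleton of [q] is a compact subset of (0, 1), and uniform convergence on it is convergence
    at [q]. *)
Lemma continuous_eval (q : R) : 0 < q < 1 -> continuous (fun g : path01 R => g q).
Proof.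
move=> q01 g.
have [gg _] := (@fam_cvgP R R (compactly_in (`]0%R, 1%R[%classic : set R))
  (nbhs (g : path01 R)) g _).
have := gg (@cvg_id _ _) [set q]; rewrite uniform_set1; apply.
split; last exact: compact_set1.
by move=> _ ->; rewrite /= in_itv.
Qed.

(** [ramp M] composed with the evaluation at [q] is a continuous bounded function of the path, to
    which weak convergence applies. *)
Lemma weakly_converges_bounded (Z : nat -> T -> path01 R) (q : R)
    {d' : measure_display} {T' : measurableType d'}
    (P' : probability T' R) (Y : T' -> path01 R) :
  0 < q < 1 -> (forall n, measurable_fun setT (fun w => Z n w q)) ->
  weakly_converges P Z P' Y -> stochastically_bounded P (fun n w => Z n w q).
Proof.
move=> q01 mZ [mY ZY].
(* Evaluation pulls open intervals back to open sets of paths, whose preimages under [Y] are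
   measurable by assumption. *)
have mV : measurable_fun setT (fun w => Y w q).
  apply: (measurability _ (RGenOpens.measurableE R)).
  move=> _ [_ [a [b ->] <-]]; rewrite setTI.
  apply: (mY [set g : path01 R | `]a, b[%classic (g q)]).
  have /continuousP cq := continuous_eval q01.
  by apply: cq; exact: interval_open.
pose V : {RV P' >-> R} := mfun_Sub (mem_set mV).
apply: (@ramp_tight _ (fun M n => outer_expectation P
  ((fun g : path01 R => ramp M (g q)) \o Z n)) _ _ _ V) => //.
  move=> M n; apply: le_ereal_inf_tmp => _ [h [ih Zh] <-].
  apply: tail_le_expectation => //.
  by apply/measurable_EFinP; exact: measurable_int ih.
move=> M; apply: ZY.
  by move=> g; apply: continuous_comp; [exact: continuous_eval|exact: continuous_ramp].
exists 1; split=> // x x1 y _; rewrite /= ger0_norm ?ramp_ge0//.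
by rewrite (le_trans (ramp_le1 _ _))// ltW.
Qed.

End Tightness.

(** * Moments and quantiles in the location-scale model *)

Section LocationScale.
Context {d : measure_display} {T : measurableType d} {R : realType}.
Variable P : probability T R.
Variables (F G : cumulativeBounded (0 : R) (1 : R)) (mu sigma : R).
Hypothesis FG : location_scale F G mu sigma.

Lemma location_scale_quantile (p : R) : 0 < p < 1 ->
  quantile F p = sigma * quantile G p + mu.
Proof.
move=> p01; rewrite -quantile_affine//; last exact: ls_sigma FG.
by congr quantile; apply/funext => x; exact: ls_FG FG x.
Qed.

Lemma has_df_variance (X : {RV P >-> R}) : has_df X F ->
  (\int[P]_w ((X w - mu) ^+ 2)%:E = (sigma ^+ 2)%:E)%E.
Proof.
move=> XF; rewrite (@has_df_ge0_integral _ _ _ _ _ F (fun x => (x - mu) ^+ 2))//.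
- exact: ls_varF FG.
- by apply: measurable_funX; exact: measurable_funB.
- by move=> x; exact: sqr_ge0.
Qed.

Lemma has_df_mean (X : {RV P >-> R}) : has_df X F ->
  (\int[P]_w (X w - mu)%:E = 0)%E.
Proof.
move=> XF; have mX : measurable_fun setT (fun w => X w - mu) by exact: measurable_funB.
have P_fin : P setT \is a fin_num by rewrite fin_num_measure.
have cmu : (cst mu : T -> R) \in Lfun P 1 by exact: Lfun_cst.
(* X - mu is square integrable, hence integrable under a probability, and so is X. *)
have X1 : (X : T -> R) \in Lfun P 1.
  rewrite (_ : (X : T -> R) = (fun w => X w - mu) + cst mu); last first.
    by apply/funext => w /=; rewrite addrfctE subrK.
  rewrite rpredD//; apply: Lfun_subset12 => //; apply: Lfun2_sqr => //.
  by rewrite has_df_variance// ltry.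
have := expectationB X1 cmu.
rewrite expectation_cst expectation.unlock.
rewrite (@has_df_integral _ _ _ _ _ F id)//; last exact/Lfun1_integrable.
by rewrite (ls_meanF FG) subee.
Qed.

(** The [fine] on the right encodes finiteness: the moment is a real number, as [iid_mean_bounded]
    requires. *)
Lemma has_df_fourth (X : {RV P >-> R}) : has_df X F ->
  (\int[P]_w (((X w - mu) ^+ 2) ^+ 2)%:E =
   (fine (\int[lebesgue_stieltjes_measure F]_x (((x - mu) ^+ 2) ^+ 2)%:E))%:E)%E.
Proof.
move=> XF.
have mX : measurable_fun setT (fun x : R => ((x - mu) ^+ 2) ^+ 2).
  by apply: measurable_funX; apply: measurable_funX; exact: measurable_funB.
rewrite -(has_df_ge0_integral XF mX) ?fineK// => [|x]; last exact: sqr_ge0.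
rewrite ge0_fin_numE; last by apply: integral_ge0 => w _; rewrite lee_fin sqr_ge0.
(* From (x - mu)^4 <= 8 x^4 + 8 mu^4, by two uses of (a + b)^2 <= 2 (a^2 + b^2). *)
apply: (@le_lt_trans _ _ (\int[P]_w ((8 * X w ^+ 4)%:E + (8 * mu ^+ 4)%:E))%E).
  apply: ge0_le_integral => //.
  - by move=> w _; rewrite lee_fin sqr_ge0.
  - by apply/measurable_EFinP; exact: (measurableT_comp mX).
  - apply: emeasurable_funD => //; apply/measurable_EFinP.
    by apply: measurable_funM => //; exact: measurable_funX.
  - move=> w _; rewrite -EFinD lee_fin; move: (X w) => x.
    apply: (@le_trans _ _ ((2 * (x ^+ 2 + mu ^+ 2)) ^+ 2)).
      rewrite lerXn2r ?nnegrE ?sqr_ge0 ?mulr_ge0 ?addr_ge0 ?sqr_ge0//.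
      by have := sqr_ge0 (x + mu); lra.
    by have := sqr_ge0 (x ^+ 2 - mu ^+ 2); lra.
rewrite ge0_integralD//=.
- rewrite [X in (_ + X)%E]integral_cst//= probability_setT mule1 lte_add_pinfty ?ltry//.
  under eq_integral do rewrite EFinM.
  rewrite ge0_integralZl_EFin//.
  + rewrite (@has_df_ge0_integral _ _ _ _ _ F (fun x => x ^+ 4))// ?lte_mul_pinfty//.
    * exact: ls_fourth FG.
    * by move=> x; rewrite (@exprM _ _ 2 2) sqr_ge0.
  + by move=> w _; rewrite lee_fin (@exprM _ _ 2 2) sqr_ge0.
  + by apply/measurable_EFinP; exact: measurable_funX.
- by move=> w _; rewrite lee_fin (@exprM _ _ 2 2) mulr_ge0 ?sqr_ge0.
- by apply/measurable_EFinP; apply: measurable_funM => //; exact: measurable_funX.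
- by move=> w _; rewrite lee_fin (@exprM _ _ 2 2) mulr_ge0 ?sqr_ge0.
Qed.

End LocationScale.

(** * Measurability of sample statistics *)

Section SampleMeasurability.
Context {d : measure_display} {T : measurableType d} {R : realType}.
Variable P : probability T R.
Variables (X : nat -> {RV P >-> R}) (n : nat).

Lemma measurable_sample : measurable_fun setT (sample X n).
Proof.
apply/measurable_fun_tnthP => i.
rewrite (_ : _ \o _ = X i)//.
by apply/funext => w /=; rewrite tnth_mktuple.
Qed.

Lemma measurable_statistic_sample (h : @statistic R) :
  measurable_statistic h -> measurable_fun setT (fun w => h n (sample X n w)).
Proof.
move=> mh; apply: (@measurableT_comp _ _ _ _ _ _ (h n) _ (sample X n)).
  exact: mh.
exact: measurable_sample.
Qed.

Lemma measurable_sample_mean :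
  measurable_fun setT (fun w => sample_mean (sample X n w)).
Proof.
apply: measurable_funM => //; apply: measurable_sum => i.
rewrite (_ : (fun _ => _) = X i)//.
by apply/funext => w; rewrite tnth_mktuple.
Qed.

Lemma measurable_sample_sd :
  measurable_fun setT (fun w => sample_sd (sample X n w)).
Proof.
apply: (@measurableT_comp _ _ _ _ _ _ (@Num.sqrt R)).
  by apply: continuous_measurable_fun; exact: sqrt_continuous.
apply: measurable_funM => //; apply: measurable_sum => i.
apply: measurable_funX; apply: measurable_funB; last exact: measurable_sample_mean.
rewrite (_ : (fun _ => _) = X i)//.
by apply/funext => w; rewrite tnth_mktuple.
Qed.

(** The inverse is viewed as the real power of exponent -1, a measurable function; the two agree on
    nonnegative reals, 0 included. *)
Lemma measurable_sample_sdV :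
  measurable_fun setT (fun w => (sample_sd (sample X n w))^-1).
Proof.
rewrite (_ : (fun _ => _) = (fun w => sample_sd (sample X n w) `^ (-1))).
  exact: measurableT_comp (measurable_powR _) measurable_sample_sd.
by apply/funext => w; rewrite powR_inv1// sqrtr_ge0.
Qed.

End SampleMeasurability.

(** * The additional sample and the quantile estimator *)

Section AdditionalSample.
Context {d : measure_display} {T : measurableType d} {R : realType}.
Variable P : probability T R.
Variables (F G : cumulativeBounded (0 : R) (1 : R)) (mu sigma Delta : R).
Hypothesis FG : location_scale F G mu sigma.
Variable X0 : nat -> {RV P >-> R}.
Hypothesis X0F : iid_sample X0 (fun x => F (x - Delta)).
Local Notation OP := (stochastically_bounded P).

Let mXD i : measurable_fun setT (fun w => X0 i w - Delta).
Proof. exact: measurable_funB. Qed.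

(** Shifting by [Delta] restores the distribution function [F], so the moment identities for [F]
    apply. *)
Let XD i : {RV P >-> R} := mfun_Sub (mem_set (mXD i)).

Let XDF i : has_df (XD i) F.
Proof.
move=> x; have := X0F.1 i (x + Delta); rewrite addrK => <-.
rewrite /cdf /distribution /pushforward/=; congr (P _).
by apply/seteqP; split => w /=; rewrite !in_itv/= lerBlDr.
Qed.

Let XDE i w : X0 i w - (mu + Delta) = XD i w - mu.
Proof. by rewrite /= opprD addrA addrAC. Qed.

Lemma additional_mean_bounded :
  OP (fun n w => Num.sqrt n%:R * (sample_mean (sample X0 n w) - (mu + Delta))).
Proof.
apply: (@stochastically_bounded_le _ _ _ _ _ (fun n w => Num.sqrt n%:R *
    ((\sum_(i < n) (X0 i w - (mu + Delta))) / n%:R - 0))).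
  exists 1%N => // n /= n0 w; rewrite subr0.
  rewrite /sample_mean (eq_bigr (fun i : 'I_n => X0 i w)); last first.
    by move=> i _; rewrite tnth_mktuple.
  rewrite (_ : (\sum_(i < n) (X0 i w - (mu + Delta))) / n%:R =
    (\sum_(i < n) X0 i w) / n%:R - (mu + Delta))//.
  rewrite big_split/= sumr_const card_ord mulrDl -[- _ *+ n]mulr_natr mulfK//.
  by rewrite pnatr_eq0 -lt0n.
apply: (@iid_mean_bounded _ _ _ _ X0 (fun x => x - (mu + Delta)) 0 (sigma ^+ 2)).
- exact: X0F.2.
- exact: measurable_funB.
- by move=> i; under eq_integral do rewrite XDE; exact: (has_df_mean FG).
- by move=> i; under eq_integral do rewrite XDE; exact: (has_df_variance FG).
Qed.

(** The fourth moment of [F] enters here, as the second moment of the squared deviations. *)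
Lemma additional_sd_bounded :
  OP (fun n w => Num.sqrt n%:R * (sample_sd (sample X0 n w) - sigma)).
Proof.
apply: (@sample_sd_bounded _ _ _ _ _ (mu + Delta)).
- exact: ls_sigma FG.
- apply: (@iid_mean_bounded _ _ _ _ X0 (fun x => (x - (mu + Delta)) ^+ 2) (sigma ^+ 2)
    (fine (\int[lebesgue_stieltjes_measure F]_x (((x - mu) ^+ 2) ^+ 2)%:E))).
  + exact: X0F.2.
  + by apply: measurable_funX; exact: measurable_funB.
  + by move=> i; under eq_integral do rewrite XDE; exact: (has_df_variance FG).
  + by move=> i; under eq_integral do rewrite XDE; exact: (has_df_fourth FG).
- exact: additional_mean_bounded.
Qed.

Lemma additional_sdV_bounded : OP (fun n w => (sample_sd (sample X0 n w))^-1).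
Proof.
exact: stochastically_bounded_inv (ls_sigma FG) additional_sd_bounded.
Qed.

(* The summand [sigma^-2] covers the junk value [0^-1 = 0] at [S = 0]. *)
Let inv_dist (S : R) :
  `|S^-1 - sigma^-1| <= `|S - sigma| * (`|S^-1| * sigma^-1 + sigma^-2).
Proof.
have s0 := ls_sigma FG; have sV0 : 0 < sigma^-1 by rewrite invr_gt0.
have [->|S0] := eqVneq S 0.
  rewrite invr0 !sub0r !normrN normr0 mul0r add0r !gtr0_norm// expr2 invfM mulrA.
  by rewrite divff ?mul1r// gt_eqF.
have -> : S^-1 - sigma^-1 = (sigma - S) * (S^-1 * sigma^-1).
  by field; rewrite S0 gt_eqF.
rewrite normrM distrC ler_wpM2l// normrM (gtr0_norm sV0) lerDl.
by rewrite invr_ge0 sqr_ge0.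
Qed.

(** The inverse inherits the rate of S, since by [inv_dist] the remaining factor is bounded in
    probability. *)
Lemma additional_sdV_rate :
  OP (fun n w => Num.sqrt n%:R * ((sample_sd (sample X0 n w))^-1 - sigma^-1)).
Proof.
apply: (@stochastically_bounded_le _ _ _ _ _ (fun n w =>
    (Num.sqrt n%:R * (sample_sd (sample X0 n w) - sigma)) *
    (`|(sample_sd (sample X0 n w))^-1| * sigma^-1 + sigma^-2))).
  apply: nearW => n w; rewrite -mulrA normrM [leRHS]normrM ler_wpM2l//.
  apply: (le_trans (inv_dist _)); rewrite normrM ler_wpM2l//.
  by rewrite ler_norm.
apply: stochastically_boundedM; first exact: additional_sd_bounded.
apply: stochastically_boundedD; last exact: stochastically_bounded_cst.
apply: stochastically_boundedM; last exact: stochastically_bounded_cst.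
apply: stochastically_bounded_le additional_sdV_bounded.
by apply: nearW => n w; rewrite normr_id.
Qed.

Lemma measurable_scaled_error (h : @statistic R) theta n :
  measurable_statistic h -> measurable_fun setT (scaled_error X0 h theta n).
Proof.
move=> mh; apply: measurable_funM => //; apply: measurable_funB => //.
exact: measurable_statistic_sample.
Qed.

(** Centring at sigma q / S leaves a difference of two root-n errors divided by S, so that 1 / S
    enters only as a bounded factor. *)
Lemma standardized_bounded (Fm : @statistic R) (p : R) : 0 < p < 1 ->
  OP (scaled_error X0 Fm (quantile (fun x => F (x - Delta)) p)) ->
  OP (fun n w => Num.sqrt n%:R * (standardized_statistic Fm (sample X0 n w) -
    sigma * quantile G p / sample_sd (sample X0 n w))).
Proof.
move=> p01.
have -> : quantile (fun x => F (x - Delta)) p = sigma * quantile G p + (mu + Delta).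
  rewrite addrA -(location_scale_quantile FG)// -[quantile F p]mul1r -quantile_affine//.
  by congr quantile; apply/funext => x; rewrite divr1.
move=> OF.
apply: (@stochastically_bounded_le _ _ _ _ _ (fun n w =>
  (scaled_error X0 Fm (sigma * quantile G p + (mu + Delta)) n w +
    -1 * (Num.sqrt n%:R * (sample_mean (sample X0 n w) - (mu + Delta)))) *
  (sample_sd (sample X0 n w))^-1)).
  apply: nearW => n w; rewrite le_eqVlt; apply/orP; left; apply/eqP.
  by congr `|_|; rewrite /scaled_error /standardized_statistic; ring.
apply: stochastically_boundedM; last exact: additional_sdV_bounded.
apply: stochastically_boundedD => //.
apply: stochastically_boundedM; first exact: stochastically_bounded_cst.
exact: additional_mean_bounded.
Qed.

Lemma quantile_estimator_bounded (Gm : @statistic R) (p : R) : 0 < p < 1 ->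
  assumption_Q X0 (fun x => F (x - Delta)) G p Gm \/
  assumption_Q' X0 (fun x => F (x - Delta)) p Gm ->
  OP (fun n w => Num.sqrt n%:R * (Gm n (sample X0 n w) -
    sigma * quantile G p / sample_sd (sample X0 n w))).
Proof.
move=> p01 [[[mG [d' [T' [P' [V GV]]]]]|[Fm [mF [d' [T' [P' [V FV]]]]] ->]]|
            [Fm [mF [d' [T' [P' [Y FY]]]]] ->]].
(* Direct estimator: g - sigma q / S = (g - q) - sigma q (1 / S - 1 / sigma). *)
- apply: (@stochastically_bounded_le _ _ _ _ _ (fun n w =>
    scaled_error X0 Gm (quantile G p) n w + - (sigma * quantile G p) *
      (Num.sqrt n%:R * ((sample_sd (sample X0 n w))^-1 - sigma^-1)))).
    apply: nearW => n w; rewrite le_eqVlt; apply/orP; left; apply/eqP.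
    congr `|_|; rewrite /scaled_error; move: (sample_sd _)^-1 => s; field.
    by rewrite gt_eqF// (ls_sigma FG).
  apply: stochastically_boundedD.
    apply: converges_in_distribution_bounded GV => n.
    exact: measurable_scaled_error.
  apply: stochastically_boundedM; first exact: stochastically_bounded_cst.
  exact: additional_sdV_rate.
- apply: standardized_bounded => //.
  apply: converges_in_distribution_bounded FV => n.
  exact: measurable_scaled_error.
- apply: standardized_bounded => //.
  apply: (weakly_converges_bounded p01 _ FY) => n.
  by apply: measurable_scaled_error; exact: mF.
Qed.

Lemma measurable_quantile_estimator (Gm : @statistic R) (p : R) (n : nat) :
  0 < p < 1 ->
  assumption_Q X0 (fun x => F (x - Delta)) G p Gm \/
  assumption_Q' X0 (fun x => F (x - Delta)) p Gm ->
  measurable_fun setT (fun w => Gm n (sample X0 n w)).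
Proof.
have mst (h : @statistic R) : measurable_statistic h ->
    measurable_fun setT (fun w => standardized_statistic h (sample X0 n w)).
  move=> mh; apply: measurable_funM; last first.
    exact: measurable_sample_sdV.
  apply: measurable_funB; first exact: measurable_statistic_sample.
  exact: measurable_sample_mean.
move=> p01 [[[mG _]|[Fm [mF _] ->]]|[Fm [mF _] ->]].
- exact: measurable_statistic_sample.
- exact: mst.
- by apply: mst; exact: mF.
Qed.

End AdditionalSample.

(** * The remainder at a single stage *)

Section Stage.
Context {d : measure_display} {T : measurableType d} {R : realType}.
Variable P : probability T R.
Variables (F G : cumulativeBounded (0 : R) (1 : R)) (mu sigma tau p Delta : R).
Variables (X0 : nat -> {RV P >-> R}) (Gm : @statistic R).
Hypotheses (FG : location_scale F G mu sigma) (p01 : 0 < p < 1)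
  (tauF : tau = quantile F p) (X0F : iid_sample X0 (fun x => F (x - Delta)))
  (QGm : assumption_Q X0 (fun x => F (x - Delta)) G p Gm \/
         assumption_Q' X0 (fun x => F (x - Delta)) p Gm).
Variables (n m : nat -> nat) (X : nat -> nat -> {RV P >-> R}).
Hypotheses (n_gt0 : forall k, (0 < n k)%N) (m_gt0 : forall k, (0 < m k)%N)
  (XF : forall k i, (i < n k)%N -> has_df (X k i) F)
  (nm : (n k)%:R / (m k)%:R @[k --> \oo] --> (0 : R)).

(** One component of the vector remainder, with the stage left abstract so that both stages are
    instances. *)
Definition stage_remainder (k : nat) (w : T) : R :=
  let x0 := sample X0 (m k) w in
  let x := sample (X k) (n k) w in
  T_stat tau (sample_sd x0) x -
    (standardized_mean mu sigma x - Num.sqrt (n k)%:R * Gm x0).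

Let scaled_remainder (k : nat) (w : T) : R :=
  let x0 := sample X0 (m k) w in
  (sample_mean (sample (X k) (n k) w) - mu) *
    (Num.sqrt (m k)%:R * ((sample_sd x0)^-1 - sigma^-1)) +
  Num.sqrt (m k)%:R * (Gm x0 - sigma * quantile G p / sample_sd x0).

Lemma stage_remainderE k w :
  stage_remainder k w = Num.sqrt ((n k)%:R / (m k)%:R) * scaled_remainder k w.
Proof.
have m0 : Num.sqrt (m k)%:R != 0 :> R by rewrite gt_eqF// sqrtr_gt0 ltr0n.
rewrite /stage_remainder /scaled_remainder /T_stat /standardized_mean.
rewrite sqrtrM ?ler0n// sqrtrV ?ler0n//.
rewrite tauF (location_scale_quantile FG)//.
(* With the inverse generalized to [s], the identity is polynomial in [s] and holds even where the
   standard deviation vanishes. *)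
move: (sample_sd _)^-1 => s; field.
by rewrite m0 gt_eqF// (ls_sigma FG).
Qed.

Lemma measurable_stage_remainder k : measurable_fun setT (stage_remainder k).
Proof.
have mS := measurable_sample_sdV X0 (m k).
have mX := measurable_sample_mean (X k) (n k).
have mG := measurable_quantile_estimator (m k) p01 QGm.
apply: measurable_funB; last first.
  apply: measurable_funB; apply: measurable_funM => //.
  by apply: measurable_funM => //; exact: measurable_funB.
apply: measurable_funM => //; apply: measurable_funM; last exact: mS.
exact: measurable_funB.
Qed.

Let measurable_scaled_remainder k : measurable_fun setT (scaled_remainder k).
Proof.
have mS := measurable_sample_sdV X0 (m k).
have mX := measurable_sample_mean (X k) (n k).
have mG := measurable_quantile_estimator (m k) p01 QGm.
apply: measurable_funD; apply: measurable_funM => //.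
- exact: measurable_funB.
- by apply: measurable_funM => //; exact: measurable_funB.
- by apply: measurable_funB => //; exact: measurable_funM.
Qed.

(** As n >= 1, a ratio n / m below 1 / (A + 1) forces m > A. *)
Lemma additional_size_infty : m k @[k --> \oo] --> \oo.
Proof.
apply/cvgnyPge => A; have := nm.
move/cvgrPdist_lt => /(_ (A.+1%:R^-1)); rewrite invr_gt0 ltr0n => /(_ isT).
apply: filterS => k; rewrite sub0r normrN ger0_norm ?divr_ge0//.
rewrite ltr_pdivrMr ?ltr0n// mulrC ltr_pdivlMr ?ltr0n// -natrM ltr_nat => /ltnW.
apply: leq_trans; rewrite (leq_trans (leqnSn A))//.
by rewrite -{1}[A.+1]mul1n leq_mul2r n_gt0 orbT.
Qed.

Lemma stage_remainder_oP (e : R) : 0 < e ->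
  P [set w | e < `|stage_remainder k w|] @[k --> \oo] --> 0%E.
Proof.
move=> e0.
have -> : (fun k => P [set w | e < `|stage_remainder k w|]) =
    (fun k => P [set w | e < `|Num.sqrt ((n k)%:R / (m k)%:R) * scaled_remainder k w|]).
  by apply/funext => k; congr (P _); apply/funext => w; rewrite /= stage_remainderE.
apply: stochastically_bounded_oP => //.
  rewrite -(@sqrtr0 R).
  by apply: (cvg_comp _ _ nm); exact: sqrt_continuous.
(* The bounds for the additional sample, indexed by its size, are transported along [m k], which
   tends to infinity. *)
apply: stochastically_boundedD.
  apply: stochastically_boundedM.
    apply: (@sample_mean_bounded _ _ _ _ X n mu (sigma ^+ 2)) => // k i ik.
    by apply: (has_df_variance FG); exact: XF.
  exact: (stochastically_bounded_comp additional_size_infty (additional_sdV_rate FG X0F)).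
have Gm_bounded := quantile_estimator_bounded FG X0F p01 QGm.
exact: (stochastically_bounded_comp additional_size_infty Gm_bounded).
Qed.

End Stage.

(** * From single stages to the pair *)

Theorem theorem2 (R : realType) (d : measure_display) (Omega : measurableType d)
    (P : probability Omega R)
    (F G : cumulativeBounded (0 : R) (1 : R)) (mu sigma tau p Delta lambda : R)
    (X0 : nat -> {RV P >-> R}) (Y1 Y2 : {RV P >-> R})
    (n1 n2 m : nat -> nat) (X1 X2 : nat -> nat -> {RV P >-> R})
    (Gm : @statistic R) :
  let F0 := fun x : R => F (x - Delta) in
  location_scale F G mu sigma ->
  p = F tau -> 0 < p < 1 -> tau = quantile F p ->
  iid_sample X0 F0 ->
  (forall k, (0 < n1 k)%N /\ (0 < n2 k)%N /\ (0 < m k)%N) ->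
  (forall k, panel_scheme F Y1 Y2 X0 (n1 k) (n2 k) (X1 k) (X2 k)) ->
  minn (n1 k) (n2 k) @[k --> \oo] --> \oo ->
  (n1 k)%:R / (n2 k)%:R @[k --> \oo] --> lambda ->
  (maxn (n1 k) (n2 k))%:R / (m k)%:R @[k --> \oo] --> (0 : R) ->
  assumption_Q X0 F0 G p Gm \/ assumption_Q' X0 F0 p Gm ->
  oP1 P (fun k w =>
    let x0 := sample X0 (m k) w in
    let x1 := sample (X1 k) (n1 k) w in
    let x2 := sample (X2 k) (n2 k) w in
    let Sm := sample_sd x0 in
    let gm := Gm (m k) x0 in
    (T_stat tau Sm x1, T_stat tau Sm x2)
    - ((standardized_mean mu sigma x1, standardized_mean mu sigma x2)
       - (Num.sqrt (n1 k)%:R * gm, Num.sqrt (n2 k)%:R * gm))).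
Proof.
move=> F0 FG pF p01 tauF X0F n_gt0 panel _ _ nm QGm e e0.
(* Each sample size is at most the maximum, so its ratio to [m] is squeezed to 0. *)
have nm_le (n : nat -> nat) : (forall k, (n k <= maxn (n1 k) (n2 k))%N) ->
    (n k)%:R / (m k)%:R @[k --> \oo] --> (0 : R).
  move=> n_le; apply: (squeeze_cvgr _ (cvg_cst 0) nm); apply: nearW => k.
  by rewrite divr_ge0//= ler_wpM2r ?invr_ge0 ?ler0n// ler_nat.
pose r n X := stage_remainder mu sigma tau X0 Gm n m X.
have r_oP n X : (forall k, (0 < n k)%N) ->
    (forall k i, (i < n k)%N -> has_df (X k i) F) ->
    (forall k, (n k <= maxn (n1 k) (n2 k))%N) ->
    P [set w | e < `|r n X k w|] @[k --> \oo] --> 0%E.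
  move=> n0 XF n_le.
  apply: (stage_remainder_oP FG p01 tauF X0F QGm) => //; last exact: nm_le.
  by move=> k; have [_ []] := n_gt0 k.
have mr n X k : measurable [set w | e < `|r n X k w|].
  apply: measurable_normr_gt.
  exact: (measurable_stage_remainder mu sigma tau p01 QGm).
(* The norm on pairs is the maximum of the components: it exceeds [e] exactly when one component
   does, and the union bound reduces the claim to single stages. *)
apply: (@squeeze_cvge _ _ _ _ (fun=> 0%E) _ (fun k =>
  P [set w | (e < `|r n1 X1 k w|)%R] + P [set w | (e < `|r n2 X2 k w|)%R])%E).
- apply: nearW => k; rewrite measure_ge0/=.
  apply: le_trans (measureU2 _ (mr _ _ _) (mr _ _ _)).
  rewrite (_ : [set w | _] =
    [set w | e < `|r n1 X1 k w|] `|` [set w | e < `|r n2 X2 k w|])//.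
  by apply/seteqP; split => w /=; rewrite prod_normE lt_max => /orP.
- exact: cvg_cst.
- rewrite -[X in _ --> X]adde0; apply: cvgeD => //.
  + apply: r_oP => [k|k i ik|k]; first by have [] := n_gt0 k.
      exact: ps_df1 (panel k) _ ik.
    exact: leq_maxl.
  + apply: r_oP => [k|k i ik|k]; first by have [_ []] := n_gt0 k.
      exact: ps_df2 (panel k) _ ik.
    exact: leq_maxr.
Qed.
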